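(* Let $q=4$, let $e>2$ be an even integer with $e\not\equiv 0\pmod{10}$, and let $n=1\cdot q^0+2\cdot q^1+2\cdot q^2+1\cdot q^e+2\cdot q^{e+2}$. Then $$g_{n,q}\equiv X^2+S_e^2+S_3S_e+X^{2q}\,S_e^3 \pmod{X^{q^e}-X},$$ and $g_{n,q}$ is a permutation polynomial of $\mathbb{F}_{q^e}$.
   Context: For a prime power $q$ (a power of the prime $p$) and an integer $n\ge 0$, $g_{n,q}\in\mathbb{F}_p[X]$ denotes the unique polynomial satisfying $\sum_{a\in\mathbb{F}_q}(X+a)^n=g_{n,q}(X^q-X)$. For fixed $q$, $S_0=0$ and $S_k=X+X^q+X^{q^2}+\cdots+X^{q^{k-1}}$ for $k\ge1$. A polynomial over $\mathbb{F}_{q^e}$ is a permutation polynomial of $\mathbb{F}_{q^e}$ if the map it induces on $\mathbb{F}_{q^e}$ is a bijection. *)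

(* Defs.v *)
From HB Require Import structures.
From mathcomp Require Import all_boot all_order all_algebra all_fingroup.
From mathcomp Require Import all_solvable all_field ring.

Set Implicit Arguments.
Unset Strict Implicit.
Unset Printing Implicit Defensive.

Import GRing.Theory.
Local Open Scope ring_scope.

(* The canonical map 'F_p -> R, a ring morphism when R has characteristic p. *)
Definition Fp_to (p : nat) (R : nzRingType) (c : 'F_p) : R := (c : nat)%:R.

Definition base_change (p : nat) (R : nzRingType) (f : {poly 'F_p}) : {poly R} :=
  map_poly (@Fp_to p R) f.
Arguments base_change {p} R f.

Definition perm_poly (K : nzRingType) (f : {poly K}) : Prop :=
  bijective (fun x : K => f.[x]).

Definition S_poly (R : nzRingType) (q k : nat) : {poly R} :=
  \sum_(i < k) 'X^(q ^ i).
Arguments S_poly R q k : clear implicits.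

(* The equation characterizing g_{n,q}, with F in the role of F_q; p is meant
   to be the characteristic of F.  It is an identity in F[X]. *)
Definition g_spec (p : nat) (F : finFieldType) (n : nat) (g : {poly 'F_p}) : bool :=
  \sum_(a : F) ('X + a%:P) ^+ n == base_change F g \Po ('X^#|F| - 'X).

Section GPoly.

Variables (p : nat) (F : finFieldType).
Hypothesis pF : p \in [pchar F].

Let p_pr : prime p := pcharf_prime pF.

Lemma Fp_to0 : Fp_to F (0 : 'F_p) = 0.
Proof. by []. Qed.

Lemma Fp_toD (a b : 'F_p) : Fp_to F (a + b) = Fp_to F a + Fp_to F b.
Proof.
have vD : (a + b : 'F_p) = ((a + b)%N %% p)%N :> nat.
  by rewrite /=; congr (_ %% _)%N; exact: Fp_cast.
rewrite /Fp_to vD -natrD; set m := (a + b)%N.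
by rewrite [in RHS](divn_eq m p) natrD natrM (pcharf0 pF) mulr0 add0r.
Qed.

Lemma Fp_toN1 : Fp_to F (-1 : 'F_p) = -1.
Proof.
apply/eqP; rewrite -subr_eq0 opprK -[X in _ + X](_ : Fp_to F (1 : 'F_p) = 1).
  by rewrite -Fp_toD addNr Fp_to0.
by rewrite /Fp_to /= modn_small.
Qed.

Lemma Fp_to_inj : injective (@Fp_to p F).
Proof.
have inj0 (a : 'F_p) : Fp_to F a = 0 -> a = 0.
  move/eqP; rewrite /Fp_to -(dvdn_pcharf pF) => pa.
  apply/val_inj/eqP; rewrite /= -leqn0 leqNgt; apply/negP => a0.
  have := dvdn_leq a0 pa; rewrite leqNgt.
  by have := ltn_ord a; rewrite [X in (_ < X)%N]Fp_cast // => ->.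
move=> a b ab; apply/eqP; rewrite -subr_eq0; apply/eqP/inj0.
by apply: (addIr (Fp_to F b)); rewrite -Fp_toD subrK add0r.
Qed.

Lemma coef_base_change (f : {poly 'F_p}) i :
  (base_change F f)`_i = Fp_to F f`_i.
Proof. exact: coef_map_id0. Qed.

Lemma base_change_inj : injective (@base_change p F).
Proof.
move=> f g fg; apply/polyP=> i; apply: Fp_to_inj.
by rewrite -!coef_base_change fg.
Qed.

Lemma base_change0 : base_change F (0 : {poly 'F_p}) = 0.
Proof. by apply/polyP=> i; rewrite coef_base_change !coef0. Qed.

Lemma base_changeD (f g : {poly 'F_p}) :
  base_change F (f + g) = base_change F f + base_change F g.
Proof.
by apply/polyP=> i; rewrite !(coefD, coef_base_change) Fp_toD.
Qed.

Lemma base_changeXM (f : {poly 'F_p}) :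
  base_change F ('X * f) = 'X * base_change F f.
Proof.
apply/polyP=> i; rewrite coef_base_change !coefXM.
by case: i => [|i] //=; rewrite coef_base_change.
Qed.

Lemma base_changeN1 : base_change F (-1 : {poly 'F_p}) = -1.
Proof.
apply/polyP=> i; rewrite coef_base_change !coefN !coef1.
by case: i => [|i] /=; rewrite ?oppr0 ?Fp_to0 ?Fp_toN1.
Qed.

Lemma card_natr0 : #|F|%:R = 0 :> F.
Proof.
have: \sum_(a : F) (a + 1) = \sum_(a : F) a.
  rewrite [RHS](reindex_inj (addIr 1)).
  by apply: eq_bigl.
rewrite big_split /= sumr_const => /eqP.
by rewrite -[X in _ == X]addr0 (inj_eq (addrI _)) => /eqP.
Qed.

Lemma sum_pow_small j : (j < #|F|.-1)%N -> \sum_(a : F) a ^+ j = 0 :> F.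
Proof.
case: j => [|j] jF.
  by rewrite (eq_bigr (fun=> 1)) // sumr_const card_natr0.
have [b b0 bj] : exists2 b : F, b != 0 & b ^+ j.+1 != 1.
  apply/exists_inP; apply: contraTT jF => /exists_inPn all1.
  rewrite -leqNgt -ltnS -(size_XnsubC (1 : F) (ltn0Sn j)).
  rewrite -(cardC1 (0 : F)) cardE.
  apply: max_poly_roots; rewrite ?enum_uniq //.
    by rewrite -size_poly_eq0 size_XnsubC.
  apply/allP=> b; rewrite mem_enum => /all1; rewrite negbK => /eqP bj.
  by rewrite rootE !hornerE bj subrr.
have bij : \sum_(a : F) a ^+ j.+1 = b ^+ j.+1 * \sum_(a : F) a ^+ j.+1.
  rewrite [LHS](reindex_inj (mulfI b0)) mulr_sumr.
  by apply: eq_bigr => a _; rewrite exprMn.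
apply/eqP; have := congr1 (fun z => \sum_(a : F) a ^+ j.+1 - z) bij.
rewrite subrr -[X in X - _]mul1r -mulrBl => /esym/eqP.
by rewrite mulf_eq0 subr_eq0 eq_sym (negPf bj).
Qed.

Lemma sum_pow_last : \sum_(a : F) a ^+ #|F|.-1 = -1 :> F.
Proof.
have F1 := finNzRing_gt1 F.
have F1' : (0 < #|F|.-1)%N by rewrite -subn1 subn_gt0.
rewrite (bigD1 0) //= expr0n (gtn_eqF F1') add0r.
rewrite (eq_bigr (fun=> 1)) => [|a a0]; last first.
  apply: (mulfI a0); rewrite -exprS prednK ?expf_card ?mulr1 //.
  exact: ltnW.
rewrite sumr_const cardC1; apply/eqP; rewrite -subr_eq0 opprK -mulrSr.
by rewrite prednK ?card_natr0 // ltnW.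
Qed.

Lemma sum_XD_pow j : (j < #|F|)%N ->
  \sum_(a : F) ('X + a%:P) ^+ j = (if j == #|F|.-1 then -1 else 0) :> {poly F}.
Proof.
move=> jF.
under eq_bigr do rewrite exprDn.
rewrite exchange_big /=.
rewrite (eq_bigr (fun i : 'I_j.+1 =>
  'X ^+ (j - i) * (\sum_(a : F) a ^+ i)%:P *+ 'C(j, i))) => [|i _]; last first.
  rewrite rmorph_sum mulr_sumr -sumrMnl.
  by apply: eq_bigr => a _; rewrite /= polyC_exp.
have jF1 : (j <= #|F|.-1)%N by rewrite -ltnS prednK // (leq_ltn_trans _ jF).
rewrite big_ord_recr /= big1 ?add0r => [|i _]; last first.
  by rewrite sum_pow_small ?mulr0 ?mul0rn // (leq_trans (ltn_ord i)).
rewrite subnn expr0 mul1r binn mulr1n.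
have [->|nj] := eqVneq; first by rewrite sum_pow_last rmorphN.
by rewrite sum_pow_small // ltn_neqAle nj.
Qed.

Lemma g_exists n : exists g : {poly 'F_p}, g_spec F n g.
Proof.
have F1 := finNzRing_gt1 F.
elim/ltn_ind: n => n IHn; have [nF|Fn] := ltnP n #|F|.
  exists (if n == #|F|.-1 then -1 else 0); rewrite /g_spec sum_XD_pow //.
  case: ifP => _; first by rewrite base_changeN1 rmorphN rmorph1.
  by rewrite base_change0 comp_poly0.
have nE := subnK Fn; set m := (n - #|F|)%N in nE.
have mn : (m < n)%N by rewrite -nE -[X in (X < _)%N]addn0 ltn_add2l ltnW.
have m1n : (m.+1 < n)%N by rewrite -nE -addn1 ltn_add2l.
have [g0 /eqP g0E] := IHn _ mn; have [g1 /eqP g1E] := IHn _ m1n.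
exists (g1 + 'X * g0); rewrite /g_spec base_changeD base_changeXM.
rewrite comp_polyD comp_polyM comp_polyX -g0E -g1E mulr_sumr -big_split /=.
apply/eqP/eq_bigr => a _; rewrite -nE exprD exprS -mulrDl mulrC.
congr (_ * _).
have pE : #|F| = (p ^ logn p #|F|)%N by exact: (card_pprimeChar pF).
have pX : p \in [pchar {poly F}] by rewrite pchar_poly.
have FrD : ('X + a%:P) ^+ #|F| = 'X ^+ #|F| + a%:P :> {poly F}.
  have FN : [pchar {poly F}].-nat #|F|.
    by rewrite (eq_pnat _ (pcharf_eq pX)) pE pnatX pnat_id ?p_pr.
  by rewrite exprDn_pchar // -polyC_exp expf_card.
by rewrite FrD; ring.
Qed.

Lemma g_unique n (g h : {poly 'F_p}) : g_spec F n g -> g_spec F n h -> g = h.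
Proof.
have F1 := finNzRing_gt1 F.
move=> /eqP gE; rewrite /g_spec gE => /eqP gh; apply: base_change_inj.
have sz : (1 < size ('X^#|F| - 'X : {poly F})%R)%N.
  by rewrite size_polyDl ?size_polyXn ?size_polyN ?size_polyX ?ltnS // ltnW.
apply/eqP; rewrite -subr_eq0; move/eqP: gh; rewrite -subr_eq0 -comp_polyB.
by rewrite comp_poly_eq0.
Qed.

(* g_{n,q} for q = #|F|. *)
Definition g_poly (n : nat) : {poly 'F_p} := xchoose (g_exists n).

Lemma g_polyP n : g_spec F n (g_poly n).
Proof. exact: xchooseP. Qed.

Lemma g_polyE n (g : {poly 'F_p}) : g_spec F n g -> g_poly n = g.
Proof. by apply: g_unique; exact: g_polyP. Qed.

End GPoly.

(* Main.v *)
(** Write x_k = X^(4^k).  For a in F_4 one has (X + a)^(4^k) = x_k + a, and the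
    sum over a of a polynomial in a, reduced modulo a^4 - a, is minus its
    coefficient of a^3.  As x_k + x_0 is S_k evaluated at X^4 - X, this gives
    g exactly, and reducing modulo X^(4^e) - X gives the congruence.

    Let Tr be the trace from K to F_4.  Since e is even, Tr kills F_4, and then
    Tr(g(x)) = Tr(x)^2, so g(x) determines s = Tr(x).  If s = 0 then
    g(x) = x^2.  Otherwise s^3 = 1, and two points with the same image and the
    same trace s differ by s w with w + w^2 + w^4 + w^8 + w^16 = 0.  Such a w
    satisfies w^32 = w, hence w^2 = w because 5 does not divide
    [K : F_2] = 2e, and then 0 = 5w = w. *)

From HB Require Import structures.
Require Import Defs.
From mathcomp Require Import all_boot all_order all_algebra all_field.
From mathcomp Require Import ring zify.

Set Implicit Arguments.
Unset Strict Implicit.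
Unset Printing Implicit Defensive.

Import GRing.Theory.
Local Open Scope ring_scope.

(** * Extension of scalars from F_p *)

Lemma Fp_to_rmorphism (p : nat) (R : nzRingType) :
  p \in [pchar R] -> exists f : {rmorphism 'F_p -> R}, f =1 Fp_to R.
Proof.
move=> pR; have p_pr := pcharf_prime pR.
have natr_mod m : (m %% p)%:R = m%:R :> R.
  by rewrite [in RHS](divn_eq m p) natrD natrM (pcharf0 pR) mulr0 add0r.
have FpD (a b : 'F_p) : Fp_to R (a + b) = Fp_to R a + Fp_to R b.
  rewrite /Fp_to -natrD -[RHS]natr_mod; congr (_%:R).
  by rewrite /=; congr (_ %% _)%N; exact: Fp_cast.
have FpM (a b : 'F_p) : Fp_to R (a * b) = Fp_to R a * Fp_to R b.
  rewrite /Fp_to -natrM -[RHS]natr_mod; congr (_%:R).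
  by rewrite /=; congr (_ %% _)%N; exact: Fp_cast.
have Fp1 : Fp_to R (1 : 'F_p) = 1 by [].
have f_add : nmod_morphism (@Fp_to p R) by [].
have f_mul : monoid_morphism (@Fp_to p R) by [].
pose fA := GRing.isNmodMorphism.Build _ _ _ f_add.
pose fM := GRing.isMonoidMorphism.Build _ _ _ f_mul.
pose f : {rmorphism 'F_p -> R} := HB.pack (@Fp_to p R) fA fM.
by exists f.
Qed.

Lemma base_change_rmorphism (p : nat) (R : nzRingType) :
  p \in [pchar R] ->
  exists f : {rmorphism 'F_p -> R}, base_change R =1 map_poly f.
Proof.
by case/Fp_to_rmorphism=> f fE; exists f => h; apply: eq_map_poly => c.
Qed.

(** * The polynomials S_k and Frobenius powers in characteristic 2 *)

Lemma map_S_poly (R R' : nzRingType) (f : {rmorphism R -> R'}) q k :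
  map_poly f (S_poly R q k) = S_poly R' q k.
Proof. by rewrite rmorph_sum; apply: eq_bigr => i _; rewrite /= map_polyXn. Qed.

Lemma S_polyS (R : nzRingType) q k :
  S_poly R q k.+1 = S_poly R q k + 'X^(q ^ k).
Proof. exact: big_ord_recr. Qed.

Lemma S_poly0 (R : nzRingType) q : S_poly R q 0 = 0.
Proof. exact: big_ord0. Qed.

Lemma pcharD_pow2 (R : comNzRingType) (k : nat) (x y : R) :
  2%N \in [pchar R] -> (x + y) ^+ (2 ^ k) = x ^+ (2 ^ k) + y ^+ (2 ^ k).
Proof.
move=> R2; apply: exprDn_pchar.
by rewrite (eq_pnat _ (pcharf_eq R2)) pnatX pnat_id.
Qed.

Lemma pcharD_pow4 (R : comNzRingType) (k : nat) (x y : R) :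
  2%N \in [pchar R] -> (x + y) ^+ (4 ^ k) = x ^+ (4 ^ k) + y ^+ (4 ^ k).
Proof. by move=> R2; rewrite -[4%N]/(2 ^ 2)%N -expnM pcharD_pow2. Qed.

Lemma expr_pow_fix (R : nzRingType) q k (x : R) : x ^+ q = x -> x ^+ (q ^ k) = x.
Proof. by move=> xq; elim: k => [|k IHk] //; rewrite expnS exprM xq. Qed.

(** The sum telescopes: the 4^i-th power of X^4 - X is X^(4^(i+1)) - X^(4^i), and signs are
    immaterial in characteristic 2. *)
Lemma S_poly_comp (R : comNzRingType) k : 2%N \in [pchar R] ->
  S_poly R 4 k \Po ('X^4 - 'X) = 'X^(4 ^ k) + 'X.
Proof.
move=> R2; have X2 : 2%N \in [pchar {poly R}] by rewrite pchar_poly.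
elim: k => [|k IHk]; first by rewrite S_poly0 comp_poly0 addrr_pchar2.
rewrite S_polyS comp_polyD IHk comp_Xn_poly oppr_pchar2 // pcharD_pow4 //.
rewrite -exprM -expnS.
have := addrr_pchar2 X2 ('X^(4 ^ k)); set y := 'X^(4 ^ k) => yy.
by ring: yy.
Qed.

(** * The exact value of g *)

Lemma sum_F4_cubic (F : finFieldType) (c0 c1 c2 c3 : {poly F}) :
  #|F| = 4%N ->
  \sum_(a : F) (c0 + c1 * a%:P + c2 * a%:P ^+ 2 + c3 * a%:P ^+ 3) = - c3.
Proof.
move=> F4; have sumX c j : \sum_(a : F) c * a%:P ^+ j = c * (\sum_a a ^+ j)%:P.
  rewrite rmorph_sum mulr_sumr.
  by apply: eq_bigr => a _; rewrite /= polyC_exp.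
have sum_small j : (j < 3)%N -> \sum_(a : F) a ^+ j = 0.
  by move=> j3; apply: sum_pow_small; rewrite F4.
have sum3 : \sum_(a : F) a ^+ 3 = -1 by have := sum_pow_last F; rewrite F4.
have := sumX c0 0%N; under eq_bigr do rewrite expr0 mulr1; move=> sumX0.
have := sumX c1 1%N; under eq_bigr do rewrite expr1; move=> sumX1.
rewrite !big_split /= sumX0 sumX1 !sumX sum3 !sum_small //.
by rewrite !mulr0 !add0r polyCN mulrN mulr1.
Qed.

(** The factors mirror the base-4 digits of the exponent: digit 1 gives [x0] and [xe], digit 2 gives
    the squares [A], [B], [C]. Only the coefficient of [a ^+ 3] survives summation over F_4. *)
Lemma F4_product_reduction (R : comNzRingType) (x0 xe A B C a : R) :
  a ^+ 4 = a ->
  (x0 + a) * (A + a ^+ 2) * (B + a ^+ 2) * (xe + a) * (C + a ^+ 2) =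
  x0 * xe * (A * B * C)
  + ((x0 + xe) * (A * B * C) + x0 * xe * (A + B + C)
     + (A * B + A * C + B * C) + (x0 + xe)) * a
  + (x0 * xe * (A * B + A * C + B * C) + A * B * C
     + (x0 + xe) * (A + B + C) + 1) * a ^+ 2
  + ((x0 + xe) * (A * B + A * C + B * C) + x0 * xe + (A + B + C)) * a ^+ 3.
Proof. by move=> a4; ring: a4. Qed.

(** The exact value of [g_poly] for the exponent of the theorem, before
    reduction modulo ['X^(4 ^ e) - 'X]. *)
Definition G_poly (R : nzRingType) (e : nat) : {poly R} :=
  let S := S_poly R 4 in
  S e * S 2%N + S e * 'X^8 * (S e.+2 + 'X) ^+ 2
  + ('X + S 2%N + S e.+2) ^+ 2.

Lemma G_poly_spec (F : finFieldType) (e : nat) :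
  let n :=
    (1 * 4 ^ 0 + 2 * 4 ^ 1 + 2 * 4 ^ 2 + 1 * 4 ^ e + 2 * 4 ^ (e + 2))%N in
  #|F| = 4%N -> g_spec F n (G_poly 'F_2 e).
Proof.
move=> n F4.
have F2 : 2%N \in [pchar F] := card_finPcharP (p := 2) (n := 2) F4 isT.
have X2 : 2%N \in [pchar {poly F}] by rewrite pchar_poly.
have two0 : 2%:R = 0 :> {poly F} := pcharf0 X2.
have [f fE] := base_change_rmorphism F2.
rewrite /g_spec F4; apply/eqP.
have -> : base_change F (G_poly 'F_2 e) = G_poly F e.
  by rewrite fE !(rmorphD, rmorphM, rmorphXn) /= !map_S_poly !map_polyX.
pose x k : {poly F} := 'X^(4 ^ k).
have compE k : S_poly F 4 k \Po ('X^4 - 'X) = x k + 'X by exact: S_poly_comp.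
(* Substituting X^4 - X turns each S_k into [x k + 'X] and X itself into [x 1 + 'X]; repeated terms
   cancel in pairs. *)
rewrite [RHS](_ : _ = (x e + 'X) * (x 2%N + 'X)
   + (x e + 'X) * (x 1%N + 'X) ^+ 8 * (x e.+2 + x 1%N) ^+ 2
   + (x 1%N + 'X + x 2%N + x e.+2) ^+ 2); last first.
  rewrite /G_poly !(comp_polyD, comp_polyM, comp_polyX, rmorphXn) /= !compE.
  rewrite oppr_pchar2 // -['X^4]/(x 1%N).
  have XX := addrr_pchar2 X2 ('X : {poly F}).
  have -> : x e.+2 + 'X + (x 1%N + 'X) = x e.+2 + x 1%N by ring: XX.
  have -> : x 1%N + 'X + (x 2%N + 'X) = x 1%N + x 2%N by ring: XX.
  by ring.
have sqrD (y z : {poly F}) : (y + z) ^+ 2 = y ^+ 2 + z ^+ 2.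
  exact: (pcharD_pow2 1).
have XaE (a : F) k : ('X + a%:P) ^+ (4 ^ k) = x k + a%:P.
  rewrite pcharD_pow4 // (@expr_pow_fix _ 4 k a%:P) // -polyC_exp.
  by rewrite -F4 expf_card.
pose A := x 1%N ^+ 2; pose B := x 2%N ^+ 2; pose C := x e.+2 ^+ 2.
have a4 (a : F) : a%:P ^+ 4 = a%:P :> {poly F}.
  by rewrite -polyC_exp -F4 expf_card.
have expand (a : F) : ('X + a%:P) ^+ n = ('X + a%:P) * (A + a%:P ^+ 2)
    * (B + a%:P ^+ 2) * (x e + a%:P) * (C + a%:P ^+ 2).
  have XaE2 k : ('X + a%:P) ^+ (2 * 4 ^ k) = x k ^+ 2 + a%:P ^+ 2.
    by rewrite mulnC exprM XaE sqrD.
  rewrite /n !(exprD _ (_ + _)) (exprD _ (1 * _)) !mul1n.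
  by rewrite (XaE a e) (XaE2 1%N) (XaE2 2%N) (XaE2 (e + 2)%N) addn2.
under eq_bigr => a _ do rewrite expand (F4_product_reduction _ _ _ _ _ (a4 a)).
rewrite sum_F4_cubic // oppr_pchar2 //.
have x14 : x 1%N ^+ 4 = x 2%N by rewrite -exprM.
(* A fourth power shifts each [x k] to [x k.+1], and 8 = 4 * 2. *)
have -> : (x 1%N + 'X) ^+ 8 = (x 2%N + x 1%N) ^+ 2.
  by rewrite -x14 (exprM _ 4 2) (pcharD_pow4 1).
(* Both sides agree up to an even term, which is made explicit as 0 = 2 z. *)
rewrite !sqrD -/A -/B -/C -[LHS]addr0.
rewrite -[X in _ + X](mul0r ((x e + 'X) * x 2%N + 'X ^+ 2)) -two0.
have AA : A ^+ 2 = x 2%N by rewrite -exprM.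
by ring: AA.
Qed.

(** * Reduction modulo X^(4^e) - X *)

(** Only S_(e+2) needs reducing: its two top terms are X + D and X^4 + D^4, so [T] collects the
    error, a multiple of [D]. *)
Lemma G_polyE (R : comNzRingType) (e : nat) : 2%N \in [pchar R] ->
  let S := S_poly R 4 in
  let D := 'X^(4 ^ e) - 'X in
  let T := D + D ^+ 4 in
  G_poly R e = 'X^2 + S e ^+ 2 + S 3%N * S e + 'X^8 * S e ^+ 3
    + T ^+ 2 * (S e * 'X^8 + 1).
Proof.
move=> R2 S D T; have X2 : 2%N \in [pchar {poly R}] by rewrite pchar_poly.
have two0 : 2%:R = 0 :> {poly R} := pcharf0 X2.
have SeE : S e.+2 = S e + 'X + 'X^4 + T.
  rewrite /T /D /S !S_polyS oppr_pchar2 // (pcharD_pow4 1) // -exprM -expnSr.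
  move: (S_poly R 4 e) ('X^(4 ^ e)) ('X^(4 ^ e.+1)) => s y z.
  (* The right side exceeds the left by 2(X + X^4), which is added here as zero. *)
  rewrite -[LHS]addr0 -[X in _ + X](mul0r ('X + 'X^4)) -two0 expn1.
  by ring.
have S2E : S 2%N = 'X + 'X^4 by rewrite /S !S_polyS S_poly0 add0r.
have S3E : S 3%N = 'X + 'X^4 + 'X^16 by rewrite /S !S_polyS S_poly0 add0r.
rewrite /G_poly -/S S2E S3E SeE.
have -> : S e + 'X + 'X^4 + T + 'X = S e + 'X^4 + T.
  by ring: (addrr_pchar2 X2 'X).
have -> : 'X + ('X + 'X^4) + (S e + 'X + 'X^4 + T) = S e + 'X + T.
  rewrite -[RHS]addr0 -[X in _ = _ + X](mul0r ('X + 'X^4)) -two0.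
  by ring.
rewrite !(pcharD_pow2 1) // expn1.
by ring.
Qed.

(** * The trace to F_4 and injectivity on K *)

Section Trace.

Variables (K : finFieldType) (e : nat).
Hypotheses (K2 : 2%N \in [pchar K]) (cardK : #|K| = (4 ^ e)%N).

Definition trace4 (x : K) := \sum_(i < e) x ^+ (4 ^ i).

Lemma trace4D x y : trace4 (x + y) = trace4 x + trace4 y.
Proof. by rewrite -big_split; apply: eq_bigr => i _; exact: pcharD_pow4. Qed.

Lemma trace4Z c x : c ^+ 4 = c -> trace4 (c * x) = c * trace4 x.
Proof.
move=> c4; rewrite mulr_sumr; apply: eq_bigr => i _.
by rewrite exprMn (expr_pow_fix _ c4).
Qed.

Lemma trace4_sqr x : trace4 (x ^+ 2) = trace4 x ^+ 2.
Proof.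
rewrite -(pFrobenius_autE K2 (trace4 x)) [trace4 x]/trace4 rmorph_sum.
by apply: eq_bigr => i _ /=; rewrite !pFrobenius_autE -!exprM mulnC.
Qed.

Lemma trace4_pow4 x : trace4 (x ^+ 4) = trace4 x.
Proof.
have xK : x ^+ (4 ^ e) = x by rewrite -cardK expf_card.
(* The sum of e + 1 powers is split at its first term and at its last, both equal to x. *)
apply: (addrI x); transitivity (\sum_(i < e.+1) x ^+ (4 ^ i)).
  rewrite big_ord_recl expn0 expr1; congr (_ + _).
  by apply: eq_bigr => i _; rewrite -exprM -expnS.
by rewrite big_ord_recr /= xK addrC.
Qed.

Lemma trace4_fixed x : trace4 x ^+ 4 = trace4 x.
Proof. by rewrite (exprM _ 2 2) -!trace4_sqr -exprM trace4_pow4. Qed.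

Lemma trace4_const c : ~~ odd e -> c ^+ 4 = c -> trace4 c = 0.
Proof.
move=> e_even c4; rewrite -[c]mulr1 trace4Z // /trace4.
under eq_bigr do rewrite expr1n.
rewrite sumr_const card_ord -(odd_double_half e) (negPf e_even).
by rewrite add0n -mul2n mulrnA (pcharf0 K2) mul0rn mulr0.
Qed.

(** The function induced by g on K, where S_e becomes the trace. *)
Definition trace4_map (x : K) : K :=
  let s := trace4 x in
  x ^+ 2 + s ^+ 2 + (x + x ^+ 4 + x ^+ 16) * s + x ^+ 8 * s ^+ 3.

(** The four terms have traces s^2, 0, 3s^2 and s^5 = s^2, which add up to 5s^2 = s^2. *)
Lemma trace4_trace4_map x : ~~ odd e -> trace4 (trace4_map x) = trace4 x ^+ 2.
Proof.
move=> e_even; rewrite /trace4_map; set s := trace4 x.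
have s4 : s ^+ 4 = s := trace4_fixed x.
have t4 y : trace4 (y ^+ 4) = trace4 y := trace4_pow4 y.
have c4 k : (s ^+ k) ^+ 4 = s ^+ k by rewrite exprAC s4.
have t16 : trace4 (x ^+ 16) = s by rewrite (exprM _ 4 4) !t4.
have t8 : trace4 (x ^+ 8) = s ^+ 2 by rewrite (exprM _ 2 4) t4 trace4_sqr.
have tM y k : trace4 (y * s ^+ k) = s ^+ k * trace4 y by rewrite mulrC trace4Z.
rewrite !trace4D trace4_sqr (trace4_const e_even (c4 2%N)) (tM _ 1%N) tM.
rewrite !trace4D t4 t16 t8 -/s.
have ss := addrr_pchar2 K2 (s ^+ 2).
transitivity (s ^+ 2 + s ^+ 2 + s ^+ 2 + (s ^+ 2 + s ^+ 2)); first by ring: s4.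
by rewrite ss add0r addr0.
Qed.

Lemma trace4_kernel_eq0 (w : K) : ~~ odd e -> ~~ (10 %| e)%N ->
  w + w ^+ 2 + w ^+ 4 + w ^+ 8 + w ^+ 16 = 0 -> w = 0.
Proof.
move=> e_even e10 w0.
have w32 : w ^+ 32 = w.
  (* The relation and its square share these middle terms, leaving w and w^32. *)
  apply: (addrI (w ^+ 2 + w ^+ 4 + w ^+ 8 + w ^+ 16)).
  rewrite [RHS]addrC !addrA w0 -[RHS](expr0n K 2 : 0 ^+ 2 = 0) -w0.
  by rewrite !(pcharD_pow2 1) // -!exprM.
have wK : w ^+ (2 ^ (2 * e)) = w by rewrite expnM -cardK expf_card.
have wr : w ^+ (2 ^ ((2 * e) %% 5)) = w.
  rewrite -[RHS]wK [in RHS](divn_eq (2 * e) 5) expnD exprM.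
  rewrite (mulnC (_ %/ _)%N) (expnM 2 5).
  by rewrite (expr_pow_fix _ (w32 : w ^+ (2 ^ 5) = w)).
have w2 : w ^+ 2 = w.
  have : ((2 * e) %% 5 < 5)%N by rewrite ltn_mod.
  (* An even e not divisible by 10 is not divisible by 5. *)
  have : ((2 * e) %% 5 != 0)%N by lia.
  (* A nonzero residue r is invertible modulo 5, so the 2^r-th and 2^5-th power maps fixing w force
     squaring to fix it. *)
  move: wr; case: ((2 * e) %% 5)%N => [|[|[|[|[|]]]]] // wr _ _.
  - by rewrite -[RHS]w32 (exprM w 16 2) (exprM w 4 4) !wr.
  - by rewrite -[in LHS]w32 -exprM (exprM w 8 8) !wr.
  - by rewrite -[RHS]w32 (exprM w 16 2) wr.
have w4 : w ^+ 4 = w by rewrite (exprM w 2 2) !w2.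
have w8 : w ^+ 8 = w by rewrite (exprM w 4 2) w4 w2.
have w16 : w ^+ 16 = w by rewrite (exprM w 4 4) !w4.
by move: w0; rewrite w2 w4 w8 w16 addrr_pchar2 // add0r addrr_pchar2 // add0r.
Qed.

Lemma trace4_map_inj : ~~ odd e -> ~~ (10 %| e)%N -> injective trace4_map.
Proof.
move=> e_even e10 x y xy.
have sqr_inj (a b : K) : a ^+ 2 = b ^+ 2 -> a = b.
  by move=> ab; apply: (fmorph_inj (pFrobenius_aut K2)).
have st : trace4 x = trace4 y.
  by apply: sqr_inj; rewrite -!trace4_trace4_map // xy.
move: xy; rewrite /trace4_map -st; have := trace4_fixed x.
move: (trace4 x) => s s4 sxy.
have [s0|sN0] := eqVneq s 0.
  by move: sxy; rewrite s0 !expr0n /= !mulr0 !addr0 => /sqr_inj.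
have s3 : s ^+ 3 = 1 by apply: (mulfI sN0); rewrite mulr1 -exprS.
(* Scaling by s makes the relation homogeneous: as s^3 = 1, every term acquires the same factor
   s^2. *)
have wE : x + y = s * ((x + y) / s) by rewrite mulrC divfK.
suff: (x + y) / s = 0.
  by move=> w0; apply/eqP; rewrite -subr_eq0 oppr_pchar2 // wE w0 mulr0.
apply: trace4_kernel_eq0 => //; set w := _ / s in wE *.
apply: (mulfI (expf_neq0 2 sN0)); rewrite mulr0.
transitivity (((x + y) ^+ 2) + ((x + y) + (x + y) ^+ 4 + (x + y) ^+ 16) * s
   + (x + y) ^+ 8).
  by rewrite wE; ring: s3.
rewrite (pcharD_pow2 1) // (pcharD_pow2 2) // (pcharD_pow2 3) //.
rewrite (pcharD_pow2 4) // expn1.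
have xy : x ^+ 2 + (x + x ^+ 4 + x ^+ 16) * s + x ^+ 8
        = y ^+ 2 + (y + y ^+ 4 + y ^+ 16) * s + y ^+ 8.
  apply: (addIr (s ^+ 2)); move: sxy; rewrite s3 !mulr1 => sxy.
  by rewrite addrAC (addrAC _ _ (s ^+ 2)) sxy; ring.
rewrite -[RHS](addrr_pchar2 K2 (x ^+ 2 + (x + x ^+ 4 + x ^+ 16) * s + x ^+ 8)).
by rewrite [in X in _ = _ + X]xy; ring.
Qed.

End Trace.

(** * The congruence and the permutation property *)

Lemma card_pow4_pchar2 (K : finFieldType) (e : nat) :
  #|K| = (4 ^ e)%N -> 2%N \in [pchar K].
Proof.
rewrite -[4%N]/(2 ^ 2)%N -expnM => K4.
by apply: (card_finPcharP K4).
Qed.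

Theorem theorem3p2 (Fq : finFieldType) (cardFq : #|Fq| = 4%N)
    (e : nat) (e_gt2 : (2 < e)%N) (e_even : ~~ odd e) (e_mod10 : ~~ (10 %| e)%N)
    (K : finFieldType) (cardK : #|K| = (4 ^ e)%N) :
  let q := 4%N in
  let n := (1 * q ^ 0 + 2 * q ^ 1 + 2 * q ^ 2 + 1 * q ^ e + 2 * q ^ (e + 2))%N in
  let g : {poly 'F_2} := g_poly (card_finPcharP (p := 2) (n := 2) cardFq isT) n in
  let S := S_poly 'F_2 q in
  ('X^(q ^ e) - 'X %| g - ('X^2 + S e ^+ 2 + S 3%N * S e + 'X^(2 * q) * S e ^+ 3))
  /\ perm_poly (base_change K g).
Proof.
move=> q n g S.
have F2 : 2%N \in [pchar 'F_2] by exact: pchar_Fp.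
have K2 := card_pow4_pchar2 cardK.
have gE : g = G_poly 'F_2 e by apply: g_polyE; exact: G_poly_spec.
split.
  rewrite gE G_polyE // addrAC subrr add0r.
  set D := 'X^_ - 'X.
  have -> : D + D ^+ 4 = D * (1 + D ^+ 3) by ring.
  by rewrite exprMn -!mulrA dvdp_mulr.
have [f fE] := base_change_rmorphism K2.
suff gx x : (base_change K g).[x] = trace4_map e x.
  by apply: injF_bij => x y; rewrite !gx; exact: trace4_map_inj.
have -> : base_change K g = G_poly K e.
  by rewrite gE fE !(rmorphD, rmorphM, rmorphXn) /= !map_S_poly !map_polyX.
have xK : x ^+ (4 ^ e) = x by rewrite -cardK expf_card.
have Sx k : (S_poly K 4 k).[x] = \sum_(i < k) x ^+ (4 ^ i).
  by rewrite horner_sum; apply: eq_bigr => i _; rewrite hornerXn.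
(* Since x^(4^e) = x, the polynomial D vanishes at x and the error term drops out. *)
rewrite G_polyE // !(hornerE, horner_exp) xK !Sx !big_ord_recr big_ord0 /=.
rewrite expn0 expn1 -[(4 ^ 2)%N]/16%N -/(trace4 e x) /trace4_map.
by ring.
Qed.
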